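(* Let $A\in\{0,\ast\}^{d\times d}$ be such that every state vertex of $G(A)$ has a self-loop, let $C\in\{0,\ast\}^{p\times d}$, and let $1\le r\le p$. Let $\hat S$ be an optimal solution of $$\max_{S\subset\mathcal{C}}\ \frac{\Xi(S)}{d}\quad\text{subject to}\quad |S|\le r ,$$ and let $S^*$ be a set returned by the following greedy algorithm: start with $S^*=\emptyset$; for at most $r$ iterations, choose $s^*\in\operatorname{arg\,max}_{s\in\mathcal{C}\setminus S^*}\big(\Xi(S^*\cup\{s\})-\Xi(S^* )\big)$ and replace $S^*$ by $S^*\cup\{s^*\}$, stopping early if $\Xi(S^* )=d$; return $S^*$. Then $$\frac{\Xi(S^* )}{d}\ \ge\ \Big(1-\frac1e\Big)\frac{\Xi(\hat S)}{d}.$$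
   Context: A sparsity matrix is a matrix with entries in $\{0,\ast\}$, where $0$ is a fixed zero and each $\ast$ is an independent free real parameter. For $A\in\{0,\ast\}^{d\times d}$ and $C\in\{0,\ast\}^{p\times d}$, the digraph $G(A,C)$ has vertex set $\mathcal{A}\sqcup\mathcal{C}$, with state vertices $\mathcal{A}=\{x_1,\dots,x_d\}$ and output vertices $\mathcal{C}=\{1,\dots,p\}$, and edge set $E_A\sqcup E_C$, where $E_A=\{(x_j,x_i):A_{ij}\ne 0\}$ and $E_C=\{(x_j,i):C_{ij}\ne 0\}$; $G(A)=(\mathcal{A},E_A)$. It is assumed (without loss of generality) that each output measures at least one state, i.e. each row of $C$ has a nonzero entry. For $S\subset\mathcal{C}$, a set $\mathcal{A}'\subset\mathcal{A}$ is structurally observable by $S$ if the subgraph $G(A',C'(S))$ of $G(A,C)$ induced by $\mathcal{A}'\sqcup S$ satisfies both: (i) every state vertex in $\mathcal{A}'$ has a directed path in the induced subgraph to at least one output vertex in $S$; (ii) the induced subgraph has no contraction, i.e. there is no $T\subset\mathcal{A}'$ with $|N^+(T)|<|T|$, where $N^+(T)$ is the set of heads, in $\mathcal{A}'\sqcup S$, of edges of the induced subgraph starting in $T$. (Equivalently, the corresponding pair $(A',C'(S))$ of sparsity matrices is structurally observable, i.e. has at least one observable numerical realization.) Define $\Xi:2^{\mathcal{C}}\to\mathbb{R}$ by $\Xi(S)=\max\{|\mathcal{A}'| : \mathcal{A}'\subset\mathcal{A}\text{ is structurally observable by }S\}$. *)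

(* Defs.v *)
From mathcomp Require Import all_boot all_order all_algebra.

Set Implicit Arguments.
Unset Strict Implicit.
Unset Printing Implicit Defensive.

Import GRing.Theory Num.Theory.

(* [true] stands for a free parameter (a star), [false] for a fixed zero. *)
Definition sparsity_mx (m n : nat) := 'M[bool]_(m, n).

Section SparsityDigraph.
Variables (d p : nat) (A : sparsity_mx d d) (C : sparsity_mx p d).

(* The state x_j is [inl j]; the output i is [inr i]. *)
Definition vertex : finType := ('I_d + 'I_p)%type.

(* The digraph G(A): column index = tail, row index = head. *)
Definition state_edge : rel 'I_d := fun j i => A i j.

(* The digraph G(A, C). *)
Definition edge : rel vertex := fun u v =>
  match u, v with
  | inl j, inl i => state_edge j i
  | inl j, inr i => C i j
  | inr _, _ => false
  end.

Definition sub_vertices (X : {set 'I_d}) (S : {set 'I_p}) : {set vertex} :=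
  [set inl j | j in X] :|: [set inr i | i in S].

Definition induced_edge (X : {set 'I_d}) (S : {set 'I_p}) : rel vertex :=
  fun u v => [&& u \in sub_vertices X S, v \in sub_vertices X S & edge u v].

Definition output_reachable (X : {set 'I_d}) (S : {set 'I_p}) : bool :=
  [forall j in X, [exists i in S,
     connect (induced_edge X S) (inl j) (inr i)]].

Definition out_neighbours (X : {set 'I_d}) (S : {set 'I_p}) (T : {set 'I_d}) :
    {set vertex} :=
  [set v | [exists j in T, induced_edge X S (inl j) v]].

Definition has_contraction (X : {set 'I_d}) (S : {set 'I_p}) : bool :=
  [exists T : {set 'I_d}, (T \subset X) && (#|out_neighbours X S T| < #|T|)].

Definition struct_observable (X : {set 'I_d}) (S : {set 'I_p}) : bool :=
  output_reachable X S && ~~ has_contraction X S.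

(* The empty set of states is always structurally observable, so the default
   value 0 of [\max] plays no role. *)
Definition Xi (S : {set 'I_p}) : nat :=
  \max_(X : {set 'I_d} | struct_observable X S) #|X|.

(* Integer-valued, to avoid truncated subtraction. *)
Definition gain (S : {set 'I_p}) (s : 'I_p) : int :=
  ((Xi (s |: S))%:Z - (Xi S)%:Z)%R.

Definition greedy_choice (S : {set 'I_p}) (s : 'I_p) : Prop :=
  s \notin S /\ forall t : 'I_p, t \notin S -> (gain S t <= gain S s)%R.

(* [greedy_run k S]: some resolution of the ties in the arg max brings the
   algorithm to the set S after k iterations. *)
Inductive greedy_run : nat -> {set 'I_p} -> Prop :=
| greedy_start : greedy_run 0 set0
| greedy_step k S s :
    greedy_run k S -> Xi S <> d -> greedy_choice S s ->
    greedy_run k.+1 (s |: S).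

Definition greedy_output (r : nat) (S : {set 'I_p}) : Prop :=
  exists k : nat, [/\ k <= r, greedy_run k S & k = r \/ Xi S = d].

End SparsityDigraph.

Definition objective (R : realFieldType) d p (A : sparsity_mx d d)
    (C : sparsity_mx p d) (S : {set 'I_p}) : R :=
  ((Xi A C S)%:R / d%:R)%R.

Definition optimal_solution (R : realFieldType) d p (A : sparsity_mx d d)
    (C : sparsity_mx p d) (r : nat) (S : {set 'I_p}) : Prop :=
  #|S| <= r /\
  forall S' : {set 'I_p}, #|S'| <= r ->
    (objective R A C S' <= objective R A C S)%R.

(* Main.v *)
Require Import Defs.
From mathcomp Require Import all_boot all_order all_algebra.
From mathcomp Require Import reals sequences exp.
From mathcomp Require Import lra.

(** Self-loops exclude contractions, because every set of states is contained
    in its own out-neighbourhood.  Structural observability then reduces to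
    reachability of the outputs.  The states that reach [S] in G(A, C) induce
    a subgraph in which they still reach [S], since every state on a path to
    [S] itself reaches [S]; hence [Xi S] is the number of states that reach
    [S] ([Xi_card_observed]).  This set is the union over [s] in [S] of the
    states that reach [s], so [Xi] is a coverage function, and the problem is
    an instance of maximum coverage.

    The rest is the classical argument of Nemhauser, Wolsey and Fisher.  The
    states that a competitor [O] with at most [r] outputs covers beyond [S]
    are shared among its outputs, so one output covers at least a fraction
    [1 / r] of them ([Xi_le_sum_gain], [greedy_choice_gain]).  Each greedy step
    therefore multiplies the deficit with respect to [O] by at most [1 - 1 / r]
    ([greedy_run_deficit]), and after [r] steps the deficit is at most
    [(1 - 1 / r) ^ r <= 1 / e] times [Xi O]. *)

Import Order.TTheory GRing.Theory Num.Theory.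

(** Submodularity of coverage in the form that the greedy analysis uses: what
    [O] adds to [S] is at most the sum of what its members add one by one. *)
Lemma card_bigcup_setD_le (I T : finType) (F : I -> {set T}) (O S : {set I}) :
  #|\bigcup_(i in O) F i :\: \bigcup_(i in S) F i| <=
  \sum_(i in O) #|F i :\: \bigcup_(j in S) F j|.
Proof.
set D := \bigcup_(j in S) F j.
have -> : \bigcup_(i in O) F i :\: D = \bigcup_(i in O) (F i :\: D).
  by rewrite setDE big_distrl; apply: eq_bigr => i _; rewrite setDE.
elim/big_rec2: _ => [|i n X _ IH]; first by rewrite cards0.
by apply: leq_trans (leq_card_setU _ _) _; rewrite leq_add2l.
Qed.

Section Observed.
Variables (d p : nat) (A : sparsity_mx d d) (C : sparsity_mx p d).

Definition observed_by (i : 'I_p) : {set 'I_d} :=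
  [set j | connect (edge A C) (inl j) (inr i)].

Definition observed (S : {set 'I_p}) : {set 'I_d} :=
  \bigcup_(i in S) observed_by i.

Lemma connect_output (i k : 'I_p) :
  connect (edge A C) (inr i) (inr k) -> i = k.
Proof. by case/connectP=> -[|v q] //= _ [->]. Qed.

Lemma connect_sub_vertices (S : {set 'I_p}) (i : 'I_p) (u : vertex d p) :
  i \in S -> connect (edge A C) u (inr i) -> u \in sub_vertices (observed S) S.
Proof.
move=> iS; rewrite inE; case: u => [j|k] cu; apply/orP.
  by left; apply/imset_f/bigcupP; exists i; rewrite ?inE.
by right; apply: imset_f; rewrite (connect_output _ _ cu).
Qed.

(** Every vertex on a path to an output of [S] also has a path to it, so that
    the whole path stays in the subgraph induced by the observed states. *)
Lemma connect_observed (S : {set 'I_p}) (i : 'I_p) (u : vertex d p) :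
  i \in S -> connect (edge A C) u (inr i) ->
  connect (induced_edge A C (observed S) S) u (inr i).
Proof.
move=> iS /connectP[q]; elim: q u => [|v q IH] u /=; first by move=> _ ->.
case/andP=> uv vq lq.
have cv : connect (edge A C) v (inr i) by apply/connectP; exists q.
apply: connect_trans (IH v vq lq); apply: connect1.
rewrite /induced_edge uv !(connect_sub_vertices _ _ _ iS) //.
exact: connect_trans (connect1 uv) cv.
Qed.

Lemma output_reachable_observed (S : {set 'I_p}) :
  output_reachable A C (observed S) S.
Proof.
apply/forall_inP => j /bigcupP[i iS]; rewrite inE => ci.
by apply/exists_inP; exists i => //; apply: connect_observed.
Qed.

Lemma output_reachable_sub (X : {set 'I_d}) (S : {set 'I_p}) :
  output_reachable A C X S -> X \subset observed S.
Proof.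
move=> /forall_inP XS; apply/subsetP => j /XS /exists_inP[i iS ci].
apply/bigcupP; exists i => //; rewrite inE.
by apply: connect_sub ci => u v /and3P[_ _ uv]; apply: connect1.
Qed.

Lemma self_loops_no_contraction (X : {set 'I_d}) (S : {set 'I_p}) :
  (forall j, state_edge A j j) -> ~~ has_contraction A C X S.
Proof.
move=> hA; apply/exists_inPn => T TX; rewrite -leqNgt.
rewrite -(card_imset (mem T) (@inl_inj 'I_d 'I_p)).
apply/subset_leq_card/subsetP => _ /imsetP[j jT ->].
have jX : inl j \in sub_vertices X S.
  by rewrite inE imset_f // (subsetP TX).
by rewrite inE; apply/exists_inP; exists j; rewrite // /induced_edge jX /= hA.
Qed.

Hypothesis hA : forall j, state_edge A j j.

Lemma Xi_card_observed (S : {set 'I_p}) : Xi A C S = #|observed S|.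
Proof.
apply/eqP; rewrite eqn_leq; apply/andP; split.
  by apply/bigmax_leqP => X /andP[/output_reachable_sub/subset_leq_card].
apply: leq_bigmax_cond.
by rewrite /struct_observable output_reachable_observed self_loops_no_contraction.
Qed.

Lemma Xi_set0 : Xi A C set0 = 0.
Proof. by rewrite Xi_card_observed /observed big_set0 cards0. Qed.

Lemma Xi_le_states (S : {set 'I_p}) : Xi A C S <= d.
Proof. by rewrite Xi_card_observed -[leqRHS]card_ord max_card. Qed.

Lemma gain_card_setD (S : {set 'I_p}) (i : 'I_p) :
  gain A C S i = #|observed_by i :\: observed S|.
Proof.
rewrite /gain !Xi_card_observed /observed bigcup_setU big_set1 -/(observed S).
rewrite -(cardsID (observed S) (_ :|: _)) (setIidPr (subsetUr _ _)).
by rewrite setDUl setDv setU0 PoszD addrC addKr.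
Qed.

Lemma Xi_le_sum_gain (O S : {set 'I_p}) :
  ((Xi A C O)%:Z - (Xi A C S)%:Z <= \sum_(i in O) gain A C S i)%R.
Proof.
under eq_bigr => i _ do rewrite gain_card_setD.
rewrite -(big_morph Posz PoszD (erefl _)) lerBlDl -PoszD lez_nat.
rewrite !Xi_card_observed -(cardsID (observed S) (observed O)).
by rewrite leq_add ?card_bigcup_setD_le // subset_leq_card ?subsetIr.
Qed.

(** The maximal gain is at least the average gain of the outputs of [O].
    Outputs already in [S] are no candidates for the greedy choice, but their
    gain is 0. *)
Lemma greedy_choice_gain (r : nat) (O S : {set 'I_p}) (s : 'I_p) :
  #|O| <= r -> greedy_choice A C S s ->
  ((Xi A C O)%:Z - (Xi A C S)%:Z <= r%:Z * gain A C S s)%R.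
Proof.
move=> Or [_ smax]; have gain0 t : (0 <= gain A C S t)%R.
  by rewrite gain_card_setD.
apply: le_trans (Xi_le_sum_gain O S) _.
apply: (@le_trans _ _ (\sum_(i in O) gain A C S s)%R).
  apply: ler_sum => i _; have [iS|] := boolP (i \in S); last exact: smax.
  by rewrite {1}/gain (setUidPr _) ?sub1set // subrr.
by rewrite sumr_const -mulr_natl ler_wpM2r // natz lez_nat.
Qed.

Lemma greedy_run_deficit (F : realFieldType) (r k : nat) (O S : {set 'I_p}) :
  0 < r -> #|O| <= r -> greedy_run A C k S ->
  ((Xi A C O)%:R - (Xi A C S)%:R <=
     (1 - r%:R^-1) ^+ k * (Xi A C O)%:R :> F)%R.
Proof.
move=> r0 Or; elim=> [|{}k {}S s _ IH _ schoice].
  by rewrite Xi_set0 expr0 mul1r subr0.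
have rF0 : (0 < r%:R :> F)%R by rewrite ltr0n.
have q0 : (0 <= 1 - r%:R^-1 :> F)%R by rewrite subr_ge0 invf_le1 // ler1n.
have := greedy_choice_gain _ _ _ _ Or schoice.
rewrite /gain -(ler_int F) !(rmorphM, rmorphB) /= -!pmulrn => step.
rewrite exprS -mulrA; apply: le_trans (ler_wpM2l q0 IH).
by rewrite mulrBl mul1r lerBrDl -lerBrDr mulrC ler_pdivrMr // mulrC; lra.
Qed.

End Observed.

(** This is [1 + x <= expR x] at [x = - 1 / r], raised to the power [r]. *)
Lemma one_sub_inv_exp_le (R : realType) (r : nat) :
  0 < r -> ((1 - r%:R^-1) ^+ r <= 1 / expR 1 :> R)%R.
Proof.
move=> r0; have rR0 : (0 < r%:R :> R)%R by rewrite ltr0n.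
have q0 : (0 <= 1 - r%:R^-1 :> R)%R by rewrite subr_ge0 invf_le1 // ler1n.
have -> : (1 / expR 1 = expR (- r%:R^-1) ^+ r :> R)%R.
  by rewrite -expRM_natl mulrN mulfV ?gt_eqF // expRN div1r.
by rewrite lerXn2r ?nnegrE ?expR_ge0 // expR_ge1Dx.
Qed.

Theorem theorem5p4 (R : realType) (d p r : nat)
    (A : sparsity_mx d d) (C : sparsity_mx p d)
    (hC : forall i : 'I_p, exists j : 'I_d, C i j)
    (hA : forall j : 'I_d, state_edge A j j)
    (hr : 1 <= r <= p)
    (Shat Sstar : {set 'I_p})
    (hShat : optimal_solution R A C r Shat)
    (hSstar : greedy_output A C r Sstar) :
  (objective R A C Sstar >= (1 - 1 / expR 1) * objective R A C Shat)%R.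
Proof.
have [r0 _] := andP hr; have [Shat_r _] := hShat.
case: hSstar => k [_ run stop].
rewrite /objective mulrA ler_wpM2r ?invr_ge0 ?ler0n //.
set m : R := (Xi A C Shat)%:R%R; have m0 : (0 <= m)%R by rewrite ler0n.
rewrite mulrBl (mul1r m) lerBlDr -lerBlDl.
case: stop => [kr|full].
  apply: le_trans (greedy_run_deficit _ _ _ _ hA R _ _ _ _ r0 Shat_r run) _.
  by rewrite kr ler_wpM2r // one_sub_inv_exp_le.
(* After an early stop every state is observed, so no competitor is better. *)
have mle : (m <= (Xi A C Sstar)%:R)%R by rewrite full ler_nat Xi_le_states.
apply: (@le_trans _ _ 0%R); first by rewrite subr_le0.
by rewrite mulr_ge0 // divr_ge0 ?expR_ge0.
Qed.
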